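(* Let $T=(X\cup F,E)$ be a finite bipartite graph without multiple edges, with partitions $X$ and $F$. Suppose that to each $e\in E$ there is assigned a nonnegative integer $m_e$ such that: (H.1) For each $x\in X$ there is a nonnegative integer $M_x$ such that $m_e=M_x$ for every edge $e$ incident to $x$. (H.2) For each $f\in F$, the sum $\sum_{x\in\partial(f)}M_x$ is even. (H.3) For each $f\in F$ and each $x\in\partial(f)$, we have $\sum_{y\in\partial(f)\setminus\{x\}}M_y\ge M_x$. Then there is a finite cover $\pi:\widetilde T=(\widetilde X\cup\widetilde F,\widetilde E)\to T$ (with $\widetilde X=\pi^{-1}(X)$, $\widetilde F=\pi^{-1}(F)$) and a union $\Delta=\Delta_1\cup\dots\cup\Delta_p$ (with $p\ge 0$) of backtrackless paths $\Delta_i$ on $\widetilde T$ such that the endpoints of each $\Delta_i$ are in $\widetilde X$ and such that: (C.1) Each $\tilde f\in\widetilde F$ occurs in $\Delta$ at most once (i.e. $\tilde f$ is visited at most once in total as a vertex along all the paths $\Delta_1,\dots,\Delta_p$). (C.2) Each $\tilde e\in\widetilde E$ occurs in $\Delta$ at most once (in total among all the paths). (C.3) At each $\tilde x\in\widetilde X$, either all or none of the edges of $\widetilde T$ incident to $\tilde x$ occur in $\Delta$. (C.4) For each $e\in E$, we have $|\pi^{-1}(e)\cap\Delta|=m_e$, i.e. exactly $m_e$ edges of $\widetilde T$ lying above $e$ occur in $\Delta$.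
   Context: Graphs are undirected. For a vertex $v$, $\partial(v)$ denotes its neighborhood, the set of vertices adjacent to $v$. A bipartite graph with partitions $X$ and $F$ has vertex set the disjoint union $X\cup F$, with no two vertices of $X$ adjacent and no two vertices of $F$ adjacent; bipartite graphs have no multiple edges. A (finite, unramified) cover of a graph $G=(V,E)$ is a finite-fibered graph $\widetilde G=(\widetilde V,\widetilde E)$ (without multiple edges when $G$ is bipartite) together with a surjection $\pi:\widetilde V\to V$ which is a graph homomorphism (adjacent vertices map to adjacent vertices) such that for each $v\in V$ and each $\tilde v\in\pi^{-1}(v)$, the neighborhood $\partial(\tilde v)$ is mapped bijectively by $\pi$ onto $\partial(v)$. The map $\pi$ induces a map on edges, also written $\pi$. A sequence of edges $(e_{i_1},\dots,e_{i_k})$ of a graph is a path if the edges can be directed so that $e_{i_s}$ terminates where $e_{i_{s+1}}$ begins for $1\le s\le k-1$. It is backtrackless if $e_{i_s}\ne e_{i_{s+1}}$ for all $s$ with $1\le s\le k-1$. *)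

(* Defs.v *)
From mathcomp Require Import all_boot.

Set Implicit Arguments.
Unset Strict Implicit.
Unset Printing Implicit Defensive.

(* A finite undirected graph without loops or multiple edges.  Loops are       *)
(* automatically absent from bipartite graphs and from their covers.           *)
Record sgraph := SGraph {
  vertex :> finType;
  adj : rel vertex;
  adj_sym : symmetric adj;
  adj_irrefl : irreflexive adj
}.

Definition nbhd (G : sgraph) (v : G) : {set G} := [set w | adj v w].

(* An edge is the unordered pair of its ends, so that the map induced on edges *)
(* by p : H -> G is e |-> p @: e.                                              *)
Definition edges (G : sgraph) : {set {set G}} :=
  [set e : {set G} | [exists u : G, [exists v : G, adj u v && (e == [set u; v])]]].

Definition bipartition (G : sgraph) (X F : {set G}) : Prop :=
  [/\ X :|: F = [set: G],
      [disjoint X & F],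
      {in X &, forall u v, ~~ adj u v}
    & {in F &, forall u v, ~~ adj u v}].

(* Fibres are finite because H is a finite graph.                              *)
Definition is_cover (G H : sgraph) (p : H -> G) : Prop :=
  [/\ forall v : G, exists w : H, p w = v,
      forall u w : H, adj u w -> adj (p u) (p w)
    & forall (v : G) (w : H), p w = v ->
        {in nbhd w &, injective p} /\ p @: nbhd w = nbhd v].

Section Paths.
Variable G : sgraph.

(* A path is given together with a direction of its edges: the pair (u, v) is  *)
(* the edge {u, v} directed from u to v.  For a backtrackless path with at     *)
(* least two edges the direction is determined by the sequence of edges.       *)
Definition dart_edge (a : G * G) : {set G} := [set a.1; a.2].

Definition path_edges (d : seq (G * G)) : seq {set G} := map dart_edge d.

Definition is_path (d : seq (G * G)) : bool :=
  [&& d != [::],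
      all (fun a => adj a.1 a.2) d
    & sorted (fun a b => a.2 == b.1) d].

Definition backtrackless (d : seq (G * G)) : bool :=
  sorted (fun e e' => e != e') (path_edges d).

Definition path_vertices (d : seq (G * G)) : seq G :=
  if d is a :: _ then a.1 :: map snd d else [::].

Definition endpoints_in (A : {set G}) (d : seq (G * G)) : bool :=
  if d is a :: d' then (a.1 \in A) && ((last a d').2 \in A) else true.

(* For a family D of paths, the vertices and edges visited along all of them,  *)
(* listed with multiplicity.                                                   *)
Definition union_vertices (D : seq (seq (G * G))) : seq G :=
  flatten (map path_vertices D).

Definition union_edges (D : seq (seq (G * G))) : seq {set G} :=
  flatten (map path_edges D).

End Paths.

(* Main.v *)
Require Import Defs.
From mathcomp Require Import all_boot all_fingroup.

(* Paths x - f - y of length two suffice. By (H.2) and (H.3) there is, at each f,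
   a loopless multigraph on the neighbours of f in which x has degree M_x. Take a
   cover with N sheets, N large, assign each edge xy of the multigraph at f its
   own point over f, and choose the gluing permutations so that the points over
   f whose pair contains x are joined exactly to the first M_x points over x.
   Every pair xy then lifts to a path through its point over f, and a point over
   x has all of its edges used if it is among the first M_x, and none otherwise. *)

Set Implicit Arguments.
Unset Strict Implicit.
Unset Printing Implicit Defensive.

(** * Loopless multigraphs with prescribed degrees *)

(** By antisymmetry, everything between two equal entries of a sorted sequence equals them, so
    equality at distance [h] yields [h + 1] occurrences. *)
Lemma sorted_nth_count (T : eqType) (le : rel T) (s : seq T) (x0 : T) i h :
  reflexive le -> transitive le -> antisymmetric le -> sorted le s ->
  i + h < size s -> nth x0 s i = nth x0 s (i + h) ->
  h < count_mem (nth x0 s i) s.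
Proof.
move=> le_refl le_tr le_anti le_s ih eq_ih.
have szt : size (take h.+1 (drop i s)) = h.+1.
  by rewrite size_takel // size_drop ltn_subRL.
suff /all_pred1P eqt : all (pred1 (nth x0 s i)) (take h.+1 (drop i s)).
  have sub : subseq (take h.+1 (drop i s)) s.
    exact: subseq_trans (take_subseq _ _) (drop_subseq _ _).
  apply: leq_trans (leq_count_subseq _ sub).
  by rewrite eqt count_nseq /= eqxx mul1n szt.
apply/(all_nthP x0) => k; rewrite szt => ltk /=.
rewrite nth_take // nth_drop; apply/eqP/le_anti.
have leN := sorted_leq_nth le_tr le_refl x0 le_s.
have kh : i + k <= i + h by rewrite leq_add2l.
have lt_ik : i + k < size s := leq_ltn_trans kh ih.
have lt_i : i < size s := leq_ltn_trans (leq_addr k i) lt_ik.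
by rewrite {1}eq_ih !leN ?inE ?leq_addr.
Qed.

(* List every [x] of [A] with multiplicity [M x], equal elements contiguous, and
   pair each entry of the first half with the one half a length further: as no
   block exceeds half the length, the two entries differ. *)
Lemma loopless_pairing (T : finType) (A : {set T}) (M : T -> nat) :
  ~~ odd (\sum_(x in A) M x) ->
  (forall x, x \in A -> M x <= \sum_(y in A :\ x) M y) ->
  exists s : seq (T * T),
    [/\ size s <= \sum_(x in A) M x,
        forall a, a \in s -> [/\ a.1 != a.2, a.1 \in A & a.2 \in A]
      & forall x, x \in A -> count (fun a => x \in [:: a.1; a.2]) s = M x].
Proof.
move=> evenS leM.
(* An arbitrary total order on [T]; it only serves to make equal entries contiguous in a form that
   [sorted_nth_count] can use. *)
pose le := relpre (@enum_rank T) (fun i j => i <= j).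
have le_refl : reflexive le by move=> x /=.
have le_tr : transitive le by move=> y x z /=; apply: leq_trans.
have le_anti : antisymmetric le.
  by move=> x y /anti_leq/ord_inj/enum_rank_inj.
have le_tot : total le by move=> x y; apply: leq_total.
pose L0 := flatten [seq nseq (M x) x | x <- enum A].
pose L := sort le L0.
have sumE (F : T -> nat) : sumn [seq F x | x <- enum A] = \sum_(x in A) F x.
  by rewrite sumnE big_map big_enum.
have countL x : x \in A -> count_mem x L = M x.
  move=> xA; rewrite count_sort count_flatten -map_comp.
  rewrite sumE (bigD1 x) //= count_nseq /= eqxx mul1n big1 ?addn0 // => y.
  by case/andP=> _ /negPf nyx; rewrite count_nseq /= nyx.
have sizeL : size L = \sum_(x in A) M x.
  rewrite size_sort size_flatten /shape -map_comp -sumE.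
  by congr sumn; apply: eq_map => x /=; rewrite size_nseq.
have memL x : x \in L -> x \in A.
  rewrite mem_sort => /flattenP[_ /mapP[y yA ->]].
  by rewrite mem_nseq => /andP[_ /eqP->]; rewrite -mem_enum.
pose h := (size L)./2.
have hh : size L = h + h by rewrite addnn halfK sizeL (negPf evenS) subn0.
(* Adding [M x] to both sides of the hypothesis on [x] gives twice [M x] at most the total, which is
   [h + h]. *)
have leMh x : x \in A -> M x <= h.
  move=> xA; rewrite -leq_double -!addnn -hh sizeL (big_setD1 x) //=.
  by rewrite leq_add2l leM.
have szt : size (take h L) = h by rewrite size_takel // hh leq_addr.
have szd : size (drop h L) = h by rewrite size_drop hh addnK.
pose s := zip (take h L) (drop h L).
have szs : size s = h by rewrite size_zip szt szd minnn.
have s_neq a : a \in s -> [/\ a.1 != a.2, a.1 \in A & a.2 \in A].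
  case: a => x y /(nthP (x, y))[k]; rewrite szs nth_zip ?szt ?szd // => ltk.
  have ltkL : k < size L by rewrite hh ltn_addr.
  rewrite nth_take // nth_drop [h + k]addnC => -[ex ey] /=.
  have kh : k + h < size L by rewrite hh ltn_add2r.
  have xL : x \in L by rewrite -ex mem_nth.
  split; [|exact: memL|by apply: memL; rewrite -ey mem_nth].
  apply/eqP => exy.
  have := @sorted_nth_count _ le L x k h le_refl le_tr le_anti
    (sort_sorted le_tot L0) kh.
  rewrite ex {1}exy -ey (set_nth_default y) // => /(_ erefl).
  by rewrite countL ?memL // ltnNge leMh // memL.
exists s; split=> // [|x xA].
  by rewrite szs -sizeL hh leq_addr.
rewrite -countL // -[in RHS](cat_take_drop h L) count_cat.
have -> : take h L = unzip1 s by rewrite unzip1_zip ?szt ?szd.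
have -> : drop h L = unzip2 s by rewrite unzip2_zip ?szt ?szd.
(* No pair has [x] in both places, so the occurrences of [x] in the two halves add up to the number
   of pairs containing [x]. *)
rewrite !count_map -count_predUI [X in _ + X](_ : _ = 0) ?addn0.
  by apply: eq_count => a /=; rewrite !inE ![x == _]eq_sym.
apply/eqP; rewrite eqn0Ngt -has_count; apply/hasPn => a /s_neq[neq _ _] /=.
by apply: contra neq => /andP[/eqP-> /eqP->].
Qed.

(** * Counting and matching of sheets *)

(** Indices from [size s] up to [N] give [None] and count for nothing; this lets a short list of
    pairs be spread over [N] sheets. *)
Lemma card_onth (T : Type) (P : pred T) (s : seq T) (N : nat) :
  size s <= N -> #|[set j : 'I_N | oapp P false (onth s j)]| = count P s.
Proof.
move=> leN; rewrite -sum1_card big_mkcond /=.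
under eq_bigr do rewrite inE.
elim: s N leN => [|a s IHs] [|N] //= leN.
- by rewrite big_ord0.
- by rewrite big1 // => i _; rewrite onth_default.
- by rewrite big_ord_recl /= IHs //; case: (P a).
Qed.

(** List [A] followed by its complement, and [B] likewise; sending each entry of the first list to
    the entry of the second at the same position is the permutation. *)
Lemma perm_of_card_eq (T : finType) (A B : {set T}) :
  #|A| = #|B| -> exists s : {perm T}, forall i, (s i \in B) = (i \in A).
Proof.
move=> cAB; pose L (C : {set T}) := enum C ++ enum (~: C).
have uL C : uniq (L C).
  rewrite cat_uniq !enum_uniq /= andbT; apply/hasPn => x.
  by rewrite !mem_enum inE.
have mL C x : x \in L C by rewrite mem_cat !mem_enum inE orbN.
have szL : size (L A) = size (L B).
  by rewrite !size_cat -!cardE [#|~: A|]cardsCs [#|~: B|]cardsCs !setCK cAB.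
pose f i := nth i (L B) (index i (L A)).
have lt_i i : index i (L A) < size (L B) by rewrite -szL index_mem.
have f_inj : injective f.
  move=> i j; rewrite /f (set_nth_default j) // => /eqP.
  rewrite nth_uniq // => /eqP eij.
  rewrite -(nth_index i (mL A i)) eij (set_nth_default j) ?nth_index //.
  by rewrite index_mem.
exists (perm f_inj) => i; rewrite permE /f.
have szE : size (enum B) = size (enum A) by rewrite -!cardE.
have szEC : size (enum (~: B)) = size (enum (~: A)).
  by rewrite -!cardE [#|~: A|]cardsCs [#|~: B|]cardsCs !setCK cAB.
rewrite index_cat nth_cat szE mem_enum; case: (boolP (i \in A)) => iA.
  have lt_iA : index i (enum A) < size (enum A) by rewrite index_mem mem_enum.
  by rewrite lt_iA -mem_enum mem_nth // szE.
rewrite ltnNge leq_addr addKn; apply/negbTE; rewrite -in_setC -mem_enum.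
by rewrite mem_nth // szEC index_mem mem_enum inE.
Qed.

(** Only the block of [w] can contain [z], and [w] is listed once. In both uses [w] is the only
    possible midpoint of a path visiting [z]. *)
Lemma count_flatten_map_le1 (S T : eqType) (h : S -> seq T) (s : seq S) z w :
  uniq s -> (forall v, v \in s -> count_mem z (h v) <= (v == w)) ->
  count_mem z (flatten (map h s)) <= 1.
Proof.
move=> us hle; apply: leq_trans (leq_b1 (w \in s)).
rewrite -(count_uniq_mem _ us) count_flatten -map_comp sumnE big_map -sum1_count.
rewrite [leqRHS]big_mkcond big_seq [leqRHS]big_seq.
by apply: leq_sum => v /hle /=; case: (v == w).
Qed.

(** * Covers from permutation voltages *)

Section VoltageCover.
Variables (G : sgraph) (I : finType) (t : G -> G -> {perm I}).
Hypothesis tV : forall u v, adj u v -> t v u = (t u v)^-1%g.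

(** This is the derived graph of a permutation voltage assignment: crossing from [u] to [v] changes
    the sheet by [t u v]. *)
Definition voltage_adj (a b : G * I) := adj a.1 b.1 && (t a.1 b.1 a.2 == b.2).

Lemma voltage_adj_sym : symmetric voltage_adj.
Proof.
move=> [u i] [v j]; rewrite /voltage_adj /= [adj v u]adj_sym.
case: (boolP (adj u v)) => //= uv.
by rewrite (tV uv); apply/eqP/eqP => <-; rewrite (permK, permKV).
Qed.

Lemma voltage_adj_irrefl : irreflexive voltage_adj.
Proof. by move=> a; rewrite /voltage_adj adj_irrefl. Qed.

Definition voltage_graph := SGraph voltage_adj_sym voltage_adj_irrefl.

Lemma voltage_cover (i0 : I) : is_cover (fst : voltage_graph -> G).
Proof.
split=> [v|u w /andP[]|v [_ i] /= ->] //; first by exists (v, i0).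
split=> [[a j] [b k]|].
  by rewrite !inE /adj /= /voltage_adj /= => /andP[_ /eqP<-] /andP[_ /eqP<-] ->.
apply/setP=> w; apply/imsetP/idP => [[b]|].
  by rewrite !inE => /andP[? _] ->.
rewrite inE => vw; exists (w, t v w i) => //.
by rewrite inE /adj /= /voltage_adj /= vw eqxx.
Qed.

End VoltageCover.

(** * Edges of bipartite graphs and their two ends *)

Lemma bipartition_edge (G : sgraph) (X F e : {set G}) :
  bipartition X F -> e \in edges G ->
  exists x f, [/\ x \in X, f \in F, adj x f & e = [set x; f]].
Proof.
move=> [XF _ XX FF]; rewrite inE => /existsP[u /existsP[v /andP[uv /eqP->]]].
have inXF w : (w \in X) || (w \in F) by rewrite -in_setU XF inE.
case/orP: (inXF u) (inXF v) => [uX|uF] /orP[vX|vF].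
- by have /negP := XX u v uX vX.
- by exists u, v.
- by exists v, u; rewrite adj_sym setUC.
- by have /negP := FF u v uF vF.
Qed.

Lemma edges_set2 (G : sgraph) (u v : G) : adj u v -> [set u; v] \in edges G.
Proof.
move=> uv; rewrite inE; apply/existsP; exists u.
by apply/existsP; exists v; rewrite uv /=.
Qed.

Lemma cover_bipartition (G H : sgraph) (p : H -> G) (X F : {set G}) :
  is_cover p -> bipartition X F -> bipartition (p @^-1: X) (p @^-1: F).
Proof.
move=> [_ p_adj _] [XF dXF XX FF]; split.
- by rewrite -preimsetU XF preimsetT.
- by rewrite -setI_eq0 -preimsetI (disjoint_setI0 dXF) preimset0.
- move=> u v; rewrite !inE => uX vX.
  exact: contra (@p_adj u v) (XX _ _ uX vX).
- move=> u v; rewrite !inE => uF vF.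
  exact: contra (@p_adj u v) (FF _ _ uF vF).
Qed.

Lemma disjoint_neq (T : finType) (X F : {set T}) x f :
  [disjoint X & F] -> x \in X -> f \in F -> (x == f) = false.
Proof.
by move=> dXF xX fF; apply: contraTF xX => /eqP->; rewrite (disjointFl dXF).
Qed.

Lemma set2_disjoint_inj (T : finType) (X F : {set T}) x x' f f' :
  [disjoint X & F] -> x \in X -> x' \in X -> f \in F -> f' \in F ->
  [set x; f] = [set x'; f'] -> x = x' /\ f = f'.
Proof.
move=> dXF xX x'X fF f'F E; split; apply/eqP.
- have : x \in [set x'; f'] by rewrite -E set21.
  by rewrite !inE (disjoint_neq dXF xX f'F) orbF.
- have : f \in [set x'; f'] by rewrite -E set22.
  by rewrite !inE [f == x']eq_sym (disjoint_neq dXF x'X fF).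
Qed.

Lemma card_ord_lt N k : k <= N -> #|[set i : 'I_N | i < k]| = k.
Proof.
move=> kN; rewrite -sum1_card (eq_bigl (fun i : 'I_N => i < k)).
  by rewrite -(big_ord_widen _ (fun=> 1) kN) sum1_card card_ord.
by move=> i; rewrite inE.
Qed.

Theorem theorem3p3 (T : sgraph) (X F : {set T}) (HT : bipartition X F)
    (m : {set T} -> nat) (M : T -> nat)
    (H1 : forall x e, x \in X -> e \in edges T -> x \in e -> m e = M x)
    (H2 : forall f, f \in F -> ~~ odd (\sum_(x in nbhd f) M x))
    (H3 : forall f x, f \in F -> x \in nbhd f ->
            M x <= \sum_(y in nbhd f :\ x) M y) :
  exists (Tt : sgraph) (p : Tt -> T) (D : seq (seq (Tt * Tt))),
    let Xt := p @^-1: X in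
    let Ft := p @^-1: F in
    is_cover p /\
    (forall d, d \in D -> [/\ is_path d, backtrackless d & endpoints_in Xt d]) /\
    [/\ (* C.1 *)
        forall f, f \in Ft -> count_mem f (union_vertices D) <= 1,
        (* C.2 *)
        forall e, e \in edges Tt -> count_mem e (union_edges D) <= 1,
        (* C.3 *)
        forall x, x \in Xt ->
          (forall e, e \in edges Tt -> x \in e -> e \in union_edges D) \/
          (forall e, e \in edges Tt -> x \in e -> e \notin union_edges D)
      & (* C.4 *)
        forall e, e \in edges T ->
          #|[set e' in edges Tt | (p @: e' == e) && (e' \in union_edges D)]| = m e].
Proof.
have [XF dXF XX FF] := HT.
have nbhdX f x : f \in F -> adj f x -> x \in X.
  move=> fF fx; have : x \in X :|: F by rewrite XF inE.
  by rewrite inE => /orP[//|xF]; have /negP := FF f x fF xF.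
have nX f : f \in F -> f \in X = false by move=> fF; rewrite (disjointFl dXF).
(* Large enough for the pairs at any [f] and for the [M x] sheets over any [x]; the successor
   guarantees a sheet even when [M] vanishes, so that the projection is surjective. *)
pose N := (\sum_x M x).+1.
have le_MN (A : {set T}) : \sum_(x in A) M x <= N.
  by rewrite leqW // big_mkcond leq_sum // => x _; case: ifP.
have le_M1 x : M x <= N by have := le_MN [set x]; rewrite big_set1.
(* [g f j] is the edge of the multigraph at [f] that is assigned to the point [(f, j)], or [None] if
   that point stays unvisited. *)
have /fin_all_exists[g gP] : forall f, exists g : {ffun 'I_N -> option (T * T)},
    f \in F -> (forall j a, g j = Some a ->
                  [/\ a.1 != a.2, a.1 \in nbhd f & a.2 \in nbhd f])
      /\ (forall x, x \in nbhd f ->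
            #|[set j | oapp (fun a => x \in [:: a.1; a.2]) false (g j)]| = M x).
  move=> f; case: (boolP (f \in F)) => [fF|_]; last by exists [ffun=> None].
  have [s [szs sP sM]] := loopless_pairing (H2 f fF) (fun x => H3 f x fF).
  exists [ffun j : 'I_N => onth s j] => _; split=> [j a|x xf].
    rewrite ffunE => ja; apply: sP; rewrite -(onth_nth a _ _ _ ja) mem_nth //.
    by rewrite -onthTE ja.
  rewrite -sM // -(card_onth _ (leq_trans szs (le_MN _))).
  by apply: eq_card => j; rewrite !inE ffunE.
pose inc f j x := oapp (fun a => x \in [:: a.1; a.2]) false (g f j).
(* Only the sheets [i < M x] over [x] carry paths: the permutation along [xf]
   matches them with the sheets over [f] whose pair contains [x]. *)
have /fin_all_exists[s sP] : forall xf : T * T, exists s : {perm 'I_N},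
    xf.2 \in F -> adj xf.2 xf.1 -> forall i, inc xf.2 (s i) xf.1 = (i < M xf.1).
  move=> [x f] /=.
  case: (boolP ((f \in F) && adj f x)) => [/andP[fF fx]|/negP nfx].
    have [_ gM] := gP f fF.
    have [|s sP] :=
      @perm_of_card_eq _ [set i : 'I_N | i < M x] [set j | inc f j x].
      by rewrite card_ord_lt // gM // inE.
    by exists s => _ _ i; have := sP i; rewrite !inE.
  by exists 1%g => fF fx; case: nfx; rewrite fF.
(* [s] is indexed by pairs in the direction from [X] to [F]; the other direction must carry the
   inverse. *)
pose t u v := if u \in X then s (u, v) else (s (v, u))^-1%g.
have tV u v : adj u v -> t v u = (t u v)^-1%g.
  move=> uv; rewrite /t; case: ifPn => vX; case: ifPn => uX //.
  - by have /negP := XX u v uX vX.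
  - by rewrite invgK.
  - have inF w : w \notin X -> w \in F.
      by move=> /negPf nwX; have := in_setT w; rewrite -XF inE nwX.
    by have /negP := FF u v (inF u uX) (inF v vX).
pose Tt := voltage_graph tV; pose p : Tt -> T := fst.
have p_cover : is_cover p by exact: (voltage_cover tV ord0).
have HTt := cover_bipartition p_cover HT; have [_ dXFt _ _] := HTt.
(* For [v] over [F], this is the neighbour of [v] over [x]. *)
pose lift (v : Tt) x : Tt := (x, (s (x, v.1))^-1%g v.2).
have adj_lift v x : v.1 \in F -> adj v.1 x -> adj (lift v x) v.
  move=> vF vx; rewrite /adj /= /voltage_adj /= adj_sym vx /t (nbhdX _ _ vF vx).
  by rewrite permKV eqxx.
have adjE (a w : Tt) : a.1 \in X -> adj a w -> lift w a.1 = a.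
  case: a w => x i [f j] /= xX; rewrite /adj /= /voltage_adj /= /t xX.
  by case/andP=> _ /eqP<-; rewrite /lift permK.
pose S := [set v : Tt | (v.1 \in F) && (g v.1 v.2 != None)].
have SP v : v \in S -> exists2 a, g v.1 v.2 = Some a &
    [/\ v.1 \in F, a.1 != a.2, adj v.1 a.1 & adj v.1 a.2].
  rewrite inE => /andP[vF]; case ga: (g v.1 v.2) => [a|] // _; exists a => //.
  by have [/(_ _ _ ga)[]] := gP _ vF; rewrite !inE.
(* The default [[::]] never enters [D], since every [v] in [S] carries a pair. *)
pose through v : seq (Tt * Tt) :=
  oapp (fun a => [:: (lift v a.1, v); (v, lift v a.2)]) [::] (g v.1 v.2).
pose D := [seq through v | v <- enum S].
(* An edge of the cover has exactly one end over [F], so it determines that end and the vertex below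
   its other end. *)
have lift_edge_inj v w a b : v.1 \in F -> w.1 \in F ->
  adj v.1 a -> adj w.1 b -> [set lift v a; v] = [set lift w b; w] -> a = b /\ v = w.
  move=> vF wF va wb E.
  have [||||[-> _] -> //] := set2_disjoint_inj dXFt _ _ _ _ E; rewrite inE //.
    exact: nbhdX va.
  exact: nbhdX wb.
(* Whether an edge is used depends only on the sheet of its end over [X]. Both (C.3) and (C.4)
   follow from this. *)
have mem_edges v x : v.1 \in F -> adj v.1 x ->
    ([set lift v x; v] \in union_edges D) = ((lift v x).2 < M x).
  move=> vF vx; rewrite -(sP (x, v.1)) //= permKV /inc.
  apply/flattenP/idP => [[_ /mapP[_ /mapP[w + ->] ->]]|].
    rewrite mem_enum => wS; have [a ga [wF a12 wa1 wa2]] := SP w wS.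
    rewrite /through ga /path_edges /= !inE /dart_edge /= [[set w; _]]setUC.
    by case/orP=> /eqP/lift_edge_inj[]// -> ->; rewrite ga /= !inE eqxx ?orbT.
  case ga: (g v.1 v.2) => [a|] //= xa; exists (path_edges (through v)).
    by rewrite map_f // map_f // mem_enum inE vF ga.
  rewrite /through ga /path_edges /= !inE /dart_edge /= [[set v; _]]setUC.
  by move: xa; rewrite !inE => /orP[]/eqP<-; rewrite eqxx ?orbT.
have edge_lift e : e \in edges Tt -> exists v x,
    [/\ v.1 \in F, adj v.1 x & e = [set lift v x; v]].
  case/(bipartition_edge HTt) => a [w []]; rewrite !inE => aX wF aw ->.
  exists w, a.1; rewrite (adjE _ _ aX aw) adj_sym; split=> //.
  by have [_ p_adj _] := p_cover; apply: p_adj aw.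
exists Tt, p, D => Xt Ft; split=> //; split.
  move=> _ /mapP[v + ->]; rewrite mem_enum => /SP[a ga [vF a12 va1 va2]].
  rewrite /through ga; split.
  - have e1 := adj_lift v a.1 vF va1.
    have e2 : adj v (lift v a.2) by rewrite adj_sym adj_lift.
    by apply/and3P; split; [|apply/and3P; split|rewrite /= eqxx].
  - rewrite /backtrackless /= andbT /dart_edge /= [[set v; _]]setUC.
    by apply: contra a12 => /eqP/lift_edge_inj[]// ->.
  - by rewrite /= !inE !(nbhdX v.1).
split.
(* (C.1): the endpoints of a path lie over [X], so the only vertex it visits over [F] is its
   midpoint. *)
- move=> f; rewrite inE => fF.
  rewrite /union_vertices -map_comp.
  apply: (@count_flatten_map_le1 _ _ _ _ _ f (enum_uniq _)) => v.
  rewrite mem_enum => /SP[a ga [vF a12 va1 va2]].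
  rewrite /through /= ga /= addn0.
  have nf x : adj v.1 x -> (lift v x == f) = false.
    by move=> vx; apply: (disjoint_neq dXFt); rewrite inE // (nbhdX v.1).
  by rewrite !nf // add0n addn0.
(* (C.2): only the path through the end [w] over [F] can use the edge, and its two edges differ
   because [a.1 != a.2]. *)
- move=> e /edge_lift[w [x [wF wx ->]]].
  rewrite /union_edges -map_comp.
  apply: (@count_flatten_map_le1 _ _ _ _ _ w (enum_uniq _)) => v.
  rewrite mem_enum => /SP[a ga [vF a12 va1 va2]].
  rewrite /through /= ga /= addn0 /dart_edge /= [[set v; _]]setUC.
  have [vw|nvw] := eqVneq v w.
    have : ~~ ((a.1 == x) && (a.2 == x)).
      by apply: contra a12 => /andP[/eqP-> /eqP->].
    have eqa y : adj v.1 y -> [set lift v y; v] == [set lift w x; w] -> y == x.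
      by move=> vy /eqP/lift_edge_inj[]// ->.
    move: (eqa _ va1) (eqa _ va2).
    case: ([set lift v a.1; v] == _); case: ([set lift v a.2; v] == _) => //.
    by move=> /(_ isT)-> /(_ isT)->.
  have neqa y : adj v.1 y -> ([set lift v y; v] == [set lift w x; w]) = false.
    move=> vy; apply: contraNF nvw => /eqP/lift_edge_inj[]// _ ->.
    exact: eqxx.
  by rewrite !neqa.
- move=> [x i]; rewrite inE /= => xX.
  have edgeP e : e \in edges Tt -> (x, i) \in e ->
      (e \in union_edges D) = (i < M x).
    case/edge_lift=> v [y [vF vy ->]]; rewrite !inE => /orP[/eqP Exi|/eqP Exi].
      by rewrite mem_edges // -Exi; case: Exi => ->.
    by move: vF; rewrite -Exi /= => /nX; rewrite xX.
  case: (ltnP i (M x)) => [lti|lei]; [left|right] => e eE xe.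
    by rewrite edgeP.
  by rewrite edgeP // -leqNgt.
- move=> e eE; have [x [f [xX fF xf eq_e]]] := bipartition_edge HT eE.
  have fx : adj f x by rewrite adj_sym.
  have ex : x \in e by rewrite eq_e set21.
  rewrite (H1 x e xX eE ex) -(card_ord_lt (le_M1 x)).
  (* [up i] is the edge above [e] at the point [(x, i)]; the used edges above [e] are the [up i]
     with [i < M x]. *)
  pose up (i : 'I_N) : {set Tt} := [set (x, i); (f, s (x, f) i)].
  have up_inj : injective up.
    move=> i j /(set2_disjoint_inj dXFt)[]; rewrite ?inE //.
    by case.
  rewrite -(card_imset _ up_inj); apply: eq_card => e'; rewrite inE.
  have upE i : up i = [set lift (f, s (x, f) i) x; ((f, s (x, f) i) : Tt)].
    by rewrite /up /lift /= permK.
  apply/andP/imsetP => [[/edge_lift[[h j] [y [/= hF hy ->]]]]|[i]].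
    rewrite imsetU1 imset_set1 /= eq_e => /andP[/eqP].
    case/(set2_disjoint_inj dXF) => // [|yx hf]; first exact: nbhdX hy.
    move: hF hy; rewrite yx hf => _ _.
    rewrite mem_edges //= => lti; exists ((s (x, f))^-1%g j); rewrite ?inE //.
    by rewrite upE permKV.
  rewrite inE => lti ->; rewrite upE mem_edges //.
  split; first by apply: edges_set2; apply: adj_lift.
  by rewrite imsetU1 imset_set1 eq_e eqxx /= permK.
Qed.
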